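(* There is an algorithm that, for any finite point set $\mathcal{P} \subseteq \mathbb{R}^d$ with conic dimension $k$ and unknown weight vector $w^* \in \mathbb{R}^d$, returns the minimizer $x^* = \arg\min_{x \in \mathcal{P}} \langle w^*, x\rangle$ using at most $O(k \log k \log |\mathcal{P}|)$ comparison queries.
   Context: A comparison query takes two points $x, y \in \mathcal{P}$ and reveals whether $\langle w^*, x\rangle$ is less than, equal to, or greater than $\langle w^*, y\rangle$. For a finite set $V \subseteq \mathbb{R}^d$, $\mathrm{cone}(V) = \{\sum_{v \in V} \alpha_v v : \alpha_v \ge 0\}$ (with $\mathrm{cone}(\emptyset) = \{0\}$). For a sequence $\sigma = (y_1, \dots, y_m)$ of points, its envelope is $\mathrm{env}(\sigma) := \mathrm{cone}(\{y_j - y_i : 1 \le i \le j \le m\})$, and $\sigma^{1:t}$ denotes the prefix $(y_1,\dots,y_t)$. The conic dimension of a set $\mathcal{Y} \subseteq \mathbb{R}^d$ is the largest integer $k$ for which there is a sequence $\sigma = (y_1, \dots, y_k)$ of points of $\mathcal{Y}$ such that for every $t \in \{2, \dots, k\}$, $y_t - y_1 \notin \mathrm{env}(\sigma^{1:t-1})$. *)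

(* Defs.v *)
From HB Require Import structures.
From mathcomp Require Import all_boot all_order all_algebra.
From mathcomp Require Import finmap.
From mathcomp Require Import boolp classical_sets reals exp.

Set Implicit Arguments.
Unset Strict Implicit.
Unset Printing Implicit Defensive.

Import Order.TTheory GRing.Theory Num.Theory.

Local Open Scope classical_set_scope.
Local Open Scope fset_scope.
Local Open Scope ring_scope.

Section ConicDimension.
Variables (R : realType) (d : nat).
Implicit Types (V : {fset 'rV[R]_d}) (Y : set 'rV[R]_d) (s : seq 'rV[R]_d).

Definition inner (w x : 'rV[R]_d) : R := \sum_(i < d) w 0 i * x 0 i.

Definition cone V : set 'rV[R]_d :=
  [set u | exists2 alpha : 'rV[R]_d -> R,
     forall v, v \in V -> 0 <= alpha v & u = \sum_(v <- V) alpha v *: v].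

Definition env s : set 'rV[R]_d :=
  cone [fset s`_(nat_of_ord p.2) - s`_(nat_of_ord p.1) |
        p : 'I_(size s) * 'I_(size s) & (p.1 <= p.2)%N].

(* A sequence (y_1, ..., y_m) is stored with y_t = s`_t.-1, so that its prefix
   (y_1, ..., y_(t-1)) is take t.-1 s. *)
Definition conic_seq Y s : Prop :=
  (forall y, y \in s -> Y y) /\
  (forall t : nat, (2 <= t <= size s)%N ->
     ~ env (take t.-1 s) (s`_t.-1 - s`_0)).

Definition is_conic_dimension Y (k : nat) : Prop :=
  (exists2 s, conic_seq Y s & size s = k) /\
  (forall s, conic_seq Y s -> (size s <= k)%N).

End ConicDimension.

(* A deterministic comparison algorithm with all internal computation
   abstracted away: the next query, or the point returned, depends only on the
   answers received so far. *)
Inductive comparison_alg (T : Type) : Type :=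
| Return of T
| Compare of T & T & (comparison -> comparison_alg T).

Fixpoint queries_in (T : Type) (Q : T -> Prop) (a : comparison_alg T) : Prop :=
  match a with
  | Return _ => True
  | Compare x y next => [/\ Q x, Q y & forall c, queries_in Q (next c)]
  end.

Section Run.
Variables (T : Type) (oracle : T -> T -> comparison).

Fixpoint output (a : comparison_alg T) : T :=
  match a with
  | Return x => x
  | Compare x y next => output (next (oracle x y))
  end.

Fixpoint nqueries (a : comparison_alg T) : nat :=
  match a with
  | Return _ => 0
  | Compare x y next => (nqueries (next (oracle x y))).+1
  end.

End Run.

Definition weight_oracle (R : realType) (d : nat) (w x y : 'rV[R]_d) :
    comparison :=
  if inner w x < inner w y then Lt
  else if inner w x == inner w y then Eq else Gt.

Definition is_minimizer (R : realType) (d : nat) (P : {fset 'rV[R]_d})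
    (w x : 'rV[R]_d) : Prop :=
  x \in P /\ forall y, y \in P -> inner w x <= inner w y.

(* Main.v *)
(** Fix n = #|P| and call a point y inferred by a sequence s sorted by w when
    y - s_0 lies in env s; such a y is no better than s_0. Greedily dropping
    inferred points from a sorted sample leaves a conic sequence, hence at most
    k points, which infer every other point of the sample. So if a sample of 2k
    points infers less than 1/8 of the candidates, then for some set J of at
    most k indices, the remaining entries (at least k) all fall in a set of
    density less than 1/8 determined by J; a union bound over the 2^(2k) sets J
    shows that a random sample fails in this way with probability at most 2^-k.

    A single sample need not be good for all w at once, so the algorithm keeps
    the finite set H of orderings of P by weight vectors that agree with all the
    answers. By averaging, some sample fails for at most a fraction 2^-k of H;
    sorting it with O(k log k) comparisons either discards 1/8 of the candidates
    or divides #|H| by 2^k. The differences of points of P span a space of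
    dimension less than k, so by the Sauer-Shelah lemma initially
    #|H| <= (n^2 + 1)^k, and O(log n) rounds suffice. *)

Require Import Defs.
From HB Require Import structures.
From mathcomp Require Import all_boot all_order all_algebra.
From mathcomp Require Import zify ring.

Set Implicit Arguments.
Unset Strict Implicit.
Unset Printing Implicit Defensive.

Import Order.TTheory GRing.Theory Num.Theory.

(** * Shattered sets and the Sauer-Shelah bound *)

Section Shattering.
Variable X : finType.
Implicit Types (F : {set {set X}}) (S : {set X}).

Definition shatters F S :=
  [forall B : {set X}, (B \subset S) ==> [exists A in F, A :&: S == B]].

Lemma shattersP F S :
  reflect (forall B : {set X}, B \subset S -> exists2 A, A \in F & A :&: S = B)
          (shatters F S).
Proof.
apply: (iffP forallP) => [h B BS|h B].
  by have /implyP/(_ BS)/exists_inP[A AF /eqP AB] := h B; exists A.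
by apply/implyP => /h [A AF AB]; apply/exists_inP; exists A => //; apply/eqP.
Qed.

Lemma shattersW F F' S : F \subset F' -> shatters F S -> shatters F' S.
Proof.
move=> /subsetP FF' /shattersP h; apply/shattersP => B /h [A /FF' AF' <-].
by exists A.
Qed.

(** Shattering a set that contains x requires both traces with x and traces without x. *)
Lemma shatters_notin F S x b :
  (forall A, A \in F -> (x \in A) = b) -> shatters F S -> x \notin S.
Proof.
move=> Fx /shattersP h; apply/negP => xS.
have [|A AF AS] := h (if b then set0 else S).
  by case: b {Fx} => //; apply: sub0set.
have : x \in A :&: S = b by rewrite inE xS andbT Fx.
by rewrite AS; case: b {Fx AS}; rewrite ?inE // xS.
Qed.

Lemma shatters_setU1 F S x :
  shatters [set A in F | x \in A] S -> shatters [set A in F | x \notin A] S ->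
  shatters F (x |: S).
Proof.
move=> h1 h0.
have xS : x \notin S.
  by apply: shatters_notin h1 => A; rewrite inE => /andP[_ ->].
apply/shattersP => B BxS.
have BS : B :\ x \subset S by rewrite subDset.
have [xB|xB] := boolP (x \in B).
  have /shattersP/(_ _ BS)[A] := h1; rewrite inE => /andP[AF xA] AB.
  exists A => //; rewrite setIUr AB; apply/setP => y; rewrite !inE.
  by have [->|_] := eqVneq y x; rewrite ?xA ?xB ?andbF.
have /shattersP/(_ _ BS)[A] := h0; rewrite inE => /andP[AF xA] AB.
exists A => //; rewrite setIUr AB; apply/setP => y; rewrite !inE.
by have [->|_] := eqVneq y x; rewrite ?(negbTE xA) ?(negbTE xB) ?andbF.
Qed.

(* Pajor's strengthening of the Sauer-Shelah lemma. *)
Lemma card_shatters F : (#|F| <= #|[set S | shatters F S]|).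
Proof.
have [n] := ubnP #|F|; elim: n F => // n IH F Fn.
have [->|F0] := eqVneq F set0; first by rewrite cards0.
have [F1|] := leqP #|F| 1.
  apply: leq_trans F1 _; rewrite card_gt0; apply/set0Pn; exists set0.
  rewrite inE; apply/shattersP => B; rewrite subset0 => /eqP ->.
  by have /set0Pn[A AF] := F0; exists A => //; rewrite setI0.
move=> /card_gt1P[A0 [A1 [A0F A1F A01]]].
have [x xA] : exists x, (x \in A0) != (x \in A1).
  apply/existsP; rewrite -negb_forall; apply: contra A01 => /forallP h.
  by apply/eqP/setP => x; apply/eqP.
pose Fi := [set A in F | x \in A]; pose Fo := [set A in F | x \notin A].
have cF : #|F| = (#|Fi| + #|Fo|).
  rewrite -(cardsID [set A : {set X} | x \in A] F); congr (_ + _).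
  - by apply: eq_card => A; rewrite !inE.
  - by apply: eq_card => A; rewrite !inE andbC.
have Fi0 : (0 < #|Fi|).
  rewrite card_gt0; apply/set0Pn; have [h|h] := boolP (x \in A0).
    by exists A0; rewrite inE A0F.
  by exists A1; rewrite inE A1F; move: xA; rewrite (negbTE h); case: (x \in A1).
have Fo0 : (0 < #|Fo|).
  rewrite card_gt0; apply/set0Pn; have [h|h] := boolP (x \in A0).
    by exists A1; rewrite inE A1F; move: xA; rewrite h; case: (x \in A1).
  by exists A0; rewrite inE A0F.
have IHi : (#|Fi| <= #|[set S | shatters Fi S]|).
  by apply: IH; rewrite -ltnS (leq_trans _ Fn) // ltnS cF -addn1 leq_add2l.
have IHo : (#|Fo| <= #|[set S | shatters Fo S]|).
  by apply: IH; rewrite -ltnS (leq_trans _ Fn) // ltnS cF -add1n leq_add2r.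
have niS S : shatters Fi S -> x \notin S.
  by apply: shatters_notin => A; rewrite inE => /andP[_ ->].
have noS S : shatters Fo S -> x \notin S.
  by apply: shatters_notin => A; rewrite inE => /andP[_ /negbTE ->].
rewrite cF (leq_trans (leq_add IHi IHo)) // -cardsUI.
set U := _ :|: _; set V := _ :&: _.
(* A set S shattered by both halves is counted twice. The second count is charged to [x |: S], which
   F shatters and which neither half can shatter. *)
have <- : #|[set x |: S | S in V]| = #|V|.
  apply: card_in_imset => S S'; rewrite !inE => /andP[/niS h _] /andP[/niS h' _] e.
  by rewrite -(setU1K h) e setU1K.
rewrite -cardsUI (_ : U :&: _ = set0) ?cards0 ?addn0.
  apply: subset_leq_card; apply/subsetP => S; rewrite !inE => /orP[/orP[]|].
  - by apply: shattersW; apply/subsetP => A; rewrite inE => /andP[].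
  - by apply: shattersW; apply/subsetP => A; rewrite inE => /andP[].
  - by case/imsetP => S'; rewrite !inE => /andP[hi ho] ->; apply: shatters_setU1.
apply/setP => S; rewrite !inE; apply/negP => /andP[h /imsetP[S' _ e]].
have : x \in S by rewrite e setU11.
by apply/negP; case/orP: h => [/niS|/noS].
Qed.

(** Each such set is the range of a map from r slots to [option X], where [None] fills the spare
    slots. *)
Lemma card_small_sets r :
  (#|[set S : {set X} | #|S| <= r]| <= #|X|.+1 ^ r).
Proof.
pose D (f : {ffun 'I_r -> option X}) := [set x | Some x \in codom f].
rewrite -card_option -[r in X in (_ <= X)]card_ord -card_ffun -cardsT.
apply: leq_trans (leq_imset_card D _); apply: subset_leq_card.
apply/subsetP => S; rewrite inE => Sr; apply/imsetP.
exists [ffun i : 'I_r => nth None (map Some (enum S)) i] => //.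
apply/setP => x; rewrite inE; apply/idP/codomP => [xS|[i]].
  have ixr : (index x (enum S) < r).
    by apply: leq_trans Sr; rewrite cardE index_mem mem_enum.
  exists (Ordinal ixr); rewrite ffunE /= (nth_map x) ?nth_index ?mem_enum //.
  by rewrite index_mem mem_enum.
rewrite ffunE; have [iS|iS] := ltnP i (size (enum S)).
  by rewrite (nth_map x) // => -[->]; rewrite -mem_enum mem_nth.
by rewrite nth_default // size_map.
Qed.

End Shattering.

(** * Counting samples whose remaining entries fall in a sparse set *)

(** Once the entries at J are fixed, so is the predicate [E S]. The other [m - #|J|] entries must
    then lie in one set of density at most 1/c in Q, which costs a factor c for each of them. *)
Lemma card_sample_hits (T : finType) (m c : nat) (Q : {set T}) (J : {set 'I_m})
    (E : {ffun 'I_m -> T} -> pred T) :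
  (forall S S' : {ffun 'I_m -> T}, {in J, S =1 S'} -> E S =1 E S') ->
  (c ^ (m - #|J|) *
   #|[set S : {ffun 'I_m -> T} | [&& [forall j, S j \in Q],
        [forall j, (j \notin J) ==> E S (S j)]
      & c * #|[set x in Q | E S x]| <= #|Q|]]| <= #|Q| ^ m).
Proof.
move=> EJ; set A := [set _ | _].
have [->|/set0Pn[S0 S0A]] := eqVneq A set0; first by rewrite cards0 muln0.
have JcE : #|[predC J]| = (m - #|J|).
  by have := cardC J; rewrite card_ord => /(canRL (addKn _)).
(* The samples are split by their entries at J; [S0] only supplies a fixed filler elsewhere. *)
pose rest (S : {ffun 'I_m -> T}) := [ffun j => if j \in J then S j else S0 j].
pose G := [set R : {ffun 'I_m -> T} |
  R \in family (fun j => if j \in J then Q else [set S0 j])].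
have restG S : S \in A -> rest S \in G.
  rewrite !inE => /and3P[/forallP SQ _ _]; apply/familyP => j; rewrite ffunE.
  by case: ifP => // _; rewrite inE.
have cG : (#|G| = #|Q| ^ #|J|).
  rewrite cardsE card_family foldrE big_map big_enum /=.
  rewrite (bigID (mem J)) /= [X in (_ * X)]big1 ?muln1 => [|j /negbTE ->].
    by rewrite -prod_nat_const; apply: eq_bigr => j ->.
  by rewrite cards1.
rewrite -[#|A|]sum1_card (partition_big rest (mem G)) /= => [|S SA]; last exact: restG.
rewrite big_distrr /=.
have -> : (#|Q| ^ m = #|G| * #|Q| ^ (m - #|J|)).
  by rewrite cG -expnD subnKC // -[X in (_ <= X)]card_ord max_card.
rewrite -sum_nat_const; apply: leq_sum => R _.
rewrite sum1dep_card; set B := [set _ | _].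
have [->|/set0Pn[S]] := eqVneq B set0; first by rewrite cards0 muln0.
rewrite inE => /andP[SA /eqP SR].
(* All members of the fibre agree with S on J, so they share this set W. *)
pose W := [set x in Q | E S x].
have BW : (#|B| <= #|W| ^ (m - #|J|)).
  apply: (@leq_trans #|[set S' : {ffun 'I_m -> T} |
     S' \in family (fun j => if j \in J then [set R j] else W)]|).
    apply: subset_leq_card; apply/subsetP => S'; rewrite 2!inE.
    move=> /andP[S'A /eqP S'R]; rewrite inE; apply/familyP => j.
    case: ifP => jJ; first by rewrite inE -S'R ffunE jJ eqxx.
    move: S'A; rewrite inE => /and3P[/forallP h1 /forallP h2 _].
    rewrite !inE h1 /= (EJ S S').
      by have := h2 j; rewrite jJ.
    by move=> i iJ; have := S'R; rewrite -SR => /ffunP/(_ i); rewrite !ffunE iJ.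
  rewrite cardsE card_family foldrE big_map big_enum /=.
  rewrite (bigID (mem J)) /= big1 ?mul1n => [|j ->]; last by rewrite cards1.
  rewrite -JcE -prod_nat_const leq_eqVlt; apply/orP; left; apply/eqP.
  by apply: eq_big => j //= /negbTE ->.
apply: leq_trans (leq_mul (leqnn _) BW) _; rewrite -expnMn.
have cW : (c * #|W| <= #|Q|) by move: SA; rewrite inE => /and3P[].
by case: (m - _) => // e; rewrite leq_exp2r.
Qed.

(** * Greedy removal of inferred entries *)

Section Greedy.
Variables (T : eqType) (infer : seq T -> T -> bool).
Implicit Types (s g : seq T) (x : T).

Definition greedy s :=
  foldl (fun g x => if infer g x then g else rcons g x) [::] s.

Definition independent s :=
  forall s1 x s2, s = s1 ++ x :: s2 -> ~~ infer s1 x.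

Lemma greedy_rcons s x :
  greedy (rcons s x) =
  if infer (greedy s) x then greedy s else rcons (greedy s) x.
Proof. by rewrite /greedy foldl_rcons. Qed.

Lemma greedy_subseq s : subseq (greedy s) s.
Proof.
elim/last_ind: s => // s x IH; rewrite greedy_rcons -!cats1; case: ifP => _.
  exact: subseq_trans IH (prefix_subseq _ _).
exact: cat_subseq.
Qed.

Lemma greedy_independent s : independent (greedy s).
Proof.
elim/last_ind: s => [[]//|s x IH]; rewrite greedy_rcons.
case: ifP => // nx s1 y; elim/last_ind=> [|s2 z _].
  by rewrite cats1 => /rcons_inj[<- <-]; rewrite nx.
by rewrite -rcons_cons -rcons_cat => /rcons_inj[/IH].
Qed.

Lemma greedy_cover s x :
  (forall g y, infer (rcons g y) y) ->
  (forall g y z, infer g y -> infer (rcons g z) y) ->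
  x \in s -> infer (greedy s) x.
Proof.
move=> infer_last infer_rcons; elim/last_ind: s => // s y IH.
rewrite greedy_rcons mem_rcons inE => /predU1P[->|/IH{}IH]; case: ifP => // _.
exact: infer_rcons.
Qed.

End Greedy.

(** * Random samples: compression, union bound and averaging *)

Lemma leq_card_bigcup (I T : finType) (P : pred I) (F : I -> {set T}) :
  (#|\bigcup_(i | P i) F i| <= \sum_(i | P i) #|F i|).
Proof.
elim/big_rec2: _ => [|i n A _ IH]; first by rewrite cards0.
by apply: leq_trans (leq_card_setU _ _) _; rewrite leq_add2l.
Qed.

Section Sampling.
Variables (T : finType) (infer : seq T -> T -> bool) (k : nat).
Hypothesis infer_last : forall g x, infer (rcons g x) x.
Hypothesis infer_rcons : forall g x y, infer g x -> infer (rcons g y) x.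
Hypothesis independent_leq : forall s, independent infer s -> (size s <= k).
Implicit Types (le : rel T) (Q : {set T}).

Definition probe le m (S : {ffun 'I_m -> T}) := greedy infer (sort le (codom S)).

Definition bad_sample le Q m (S : {ffun 'I_m -> T}) :=
  (8 * #|[set x in Q | infer (probe le S) x]| < #|Q|).

(** The kept entries form an independent subsequence of the sorted sample, so at most k indices
    carry them. Antisymmetry makes sorting canonical, so sorting these entries alone gives the probe
    back. Indices are used rather than points because a sample may repeat points. *)
Lemma probe_compress le m (S : {ffun 'I_m -> T}) :
  total le -> transitive le -> antisymmetric le ->
  exists2 J : {set 'I_m}, (#|J| <= k)
    & probe le S = sort le [seq S j | j <- enum J].
Proof.
move=> le_total le_trans le_anti.
set g := probe le S.
have g_sorted : sorted le g.
  by apply: subseq_sorted (greedy_subseq _ _) (sort_sorted _ _).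
have /subseqP[b _ gE] := greedy_subseq infer (sort le (codom S)).
pose t := mask b (sort (relpre S le) (enum 'I_m)).
have gt : g = map S t by rewrite map_mask -sort_map.
have tU : uniq t by rewrite mask_uniq // sort_uniq enum_uniq.
have tJ : perm_eq t (enum [set j in t]).
  by apply: uniq_perm => // [|j]; rewrite ?enum_uniq // mem_enum inE.
exists [set j in t].
  rewrite cardE -(perm_size tJ) -(size_map S) -gt.
  exact/independent_leq/greedy_independent.
apply: (sorted_eq le_trans le_anti) => //; first exact: sort_sorted.
by rewrite perm_sym perm_sort perm_sym gt perm_map.
Qed.

(** The probe of a bad sample is determined by the entries at some small J, and it infers every
    other entry; hence the sample belongs to [A J]. The counting lemma bounds each [A J], and a
    union bound over J follows. *)
Lemma card_bad_sample le Q :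
  total le -> transitive le -> antisymmetric le ->
  (2 ^ k * #|[set S : {ffun 'I_(2 * k) -> T} |
     [forall j, S j \in Q] && bad_sample le Q S]| <= #|Q| ^ (2 * k)).
Proof.
move=> le_total le_trans le_anti.
pose E (J : {set 'I_(2 * k)}) (S : {ffun 'I_(2 * k) -> T}) :=
  infer (sort le [seq S j | j <- enum J]).
pose A (J : {set 'I_(2 * k)}) :=
  [set S : {ffun 'I_(2 * k) -> T} | [&& [forall j, S j \in Q],
        [forall j, (j \notin J) ==> E J S (S j)]
      & 8 * #|[set x in Q | E J S x]| <= #|Q|]].
have cA (J : {set 'I_(2 * k)}) : (8 ^ (2 * k - #|J|) * #|A J| <= #|Q| ^ (2 * k)).
  apply: card_sample_hits => S S' SS' x; rewrite /E.
  by congr (infer (sort _ _) x); apply/eq_in_map => j; rewrite mem_enum => /SS'.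
set B := [set _ | _].
have BA : (#|B| <= \sum_(J : {set 'I_(2 * k)} | (#|J| <= k)) #|A J|).
  apply: leq_trans (leq_card_bigcup _ _).
  apply: subset_leq_card; apply/subsetP => S; rewrite inE => /andP[SQ Sbad].
  have [J Jk SJ] := probe_compress S le_total le_trans le_anti.
  apply/bigcupP; exists J => //; rewrite inE SQ /=; apply/andP; split.
    apply/forall_inP => j jJ; rewrite /E -SJ.
    by apply: greedy_cover; rewrite ?mem_sort ?codom_f.
  by apply: ltnW; rewrite /bad_sample SJ in Sbad.
(* There are [4 ^ k] sets J in all, and [4 ^ k * 2 ^ k = 8 ^ k] is at most [8 ^ (2 * k - #|J|)] when
   J has at most k elements. *)
rewrite -(@leq_pmul2l (4 ^ k)) ?expn_gt0 // mulnA -expnMn.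
apply: leq_trans (leq_mul (leqnn _) BA) _; rewrite big_distrr /=.
apply: (@leq_trans (\sum_(J : {set 'I_(2 * k)}) #|Q| ^ (2 * k))).
  rewrite [in X in (_ <= X)](bigID (fun J : {set _} => #|J| <= k)) /=.
  apply: leq_trans (leq_addr _ _); apply: leq_sum => J Jk.
  apply: leq_trans (cA J); rewrite leq_mul2r leq_exp2l //.
  suff -> : k <= 2 * k - #|J| by rewrite orbT.
  by move: #|J| Jk => c ck; rewrite mul2n -addnn -addnBA // leq_addr.
by rewrite sum_nat_const -cardsT -powersetT card_powerset cardsT card_ord expnM.
Qed.

(** Double counting of the pairs of a sample and an order for which it is bad: if every sample
    failed for too many orders of H, the total would exceed the bound summed over the orders. *)
Lemma exists_good_sample (I : finType) (H : {set I}) (le : I -> rel T) Q :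
  (forall i, [/\ total (le i), transitive (le i) & antisymmetric (le i)]) ->
  Q != set0 ->
  exists2 S : {ffun 'I_(2 * k) -> T}, (forall j, S j \in Q)
    & (2 ^ k * #|[set i in H | bad_sample (le i) Q S]| <= #|H|).
Proof.
move=> leP Q0.
pose QS := [set S : {ffun 'I_(2 * k) -> T} | [forall j, S j \in Q]].
have cQS : #|QS| = (#|Q| ^ (2 * k)).
  rewrite -[in RHS](card_ord (2 * k)) -card_ffun_on; apply: eq_card => S.
  by rewrite inE; apply/forallP/ffun_onP.
have QS0 : (0 < #|QS|) by rewrite cQS expn_gt0 card_gt0 Q0.
have [/existsP[S /andP[/forallP SQ SH]]|/existsPn none] :=
  boolP [exists S : {ffun 'I_(2 * k) -> T}, [forall j, S j \in Q] &&
    (2 ^ k * #|[set i in H | bad_sample (le i) Q S]| <= #|H|)].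
  by exists S.
have : (\sum_(S in QS) (#|H|).+1 <= #|H| * #|Q| ^ (2 * k)).
  rewrite -sum_nat_const.
  apply: (@leq_trans (\sum_(S in QS)
    2 ^ k * \sum_(i in H | bad_sample (le i) Q S) 1)).
    apply: leq_sum => S; rewrite inE => SQ; have := none S.
    by rewrite SQ /= -ltnNge sum1dep_card.
  rewrite -big_distrr /= (exchange_big_dep (mem H)) /= => [|? ? _ /andP[]//].
  rewrite big_distrr /=; apply: leq_sum => i iH.
  have [h1 h2 h3] := leP i.
  apply: leq_trans (card_bad_sample Q h1 h2 h3); rewrite leq_mul2l sum1dep_card.
  apply/orP; right; apply: subset_leq_card; apply/subsetP => S.
  by rewrite !inE => /and3P[-> _ ->].
by rewrite sum_nat_const cQS mulnC leq_pmul2r -?cQS // ltnn.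
Qed.

End Sampling.

(** * Sorting by binary insertion as a comparison tree *)

Section SortingTrees.
Variables (T : finType).
Implicit Types (x y : T) (s : seq T) (K : seq T -> comparison_alg T).

(* Ties are broken by the enumeration of T, so that sorting is canonical. *)
Definition tiebreak x y (c : comparison) : bool :=
  match c with
  | Lt => true
  | Eq => enum_rank x <= enum_rank y
  | Gt => false
  end.

Definition oracle_le (o : T -> T -> comparison) : rel T :=
  fun x y => tiebreak x y (o x y).

Arguments oracle_le : simpl never.

Definition branch x y (K : bool -> comparison_alg T) :=
  Compare x y (fun c => K (tiebreak x y c)).

(** Binary insertion in continuation-passing style: K receives the resulting list and supplies the
    rest of the algorithm. The fuel c bounds the number of comparisons. *)
Fixpoint insert_tree c x s K : comparison_alg T :=
  if c is c'.+1 then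
    let: s1 := take (size s)./2 s in
    if drop (size s)./2 s is y :: s2 then
      branch x y (fun b =>
        if b then insert_tree c' x s1 (fun s' => K (s' ++ y :: s2))
        else insert_tree c' x s2 (fun s' => K (s1 ++ y :: s')))
    else K [:: x]
  else K [:: x].

Fixpoint sort_tree c s acc K : comparison_alg T :=
  if s is x :: s' then
    insert_tree c x acc (fun acc' => sort_tree c s' acc' K)
  else K acc.

Variable o : T -> T -> comparison.
Hypothesis le_total : total (oracle_le o).
Hypothesis le_trans : transitive (oracle_le o).
Local Notation le := (oracle_le o).

(** Removing the middle entry leaves two parts of size less than [2 ^ c.-1], so c comparisons locate
    x. *)
Lemma insert_treeP c x s K : sorted le s -> size s < 2 ^ c ->
  exists2 s', sorted le s' /\ perm_eq s' (x :: s)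
    & output o (insert_tree c x s K) = output o (K s') /\
      nqueries o (insert_tree c x s K) <= c + nqueries o (K s').
Proof.
elim: c s K => [|c IH] s K /= ss sc.
  by exists [:: x] => //; case: s ss sc.
case: (size s =P 0) => [/size0nil ->|/eqP s0] /=.
  by exists [:: x] => //; rewrite leq_addl.
rewrite -lt0n in s0.
rewrite expnS in sc.
have h2 : (size s)./2 < size s by lia.
have s1c : size (take (size s)./2 s) < 2 ^ c by rewrite size_take h2; lia.
have : size (drop (size s)./2 s) <= 2 ^ c by rewrite size_drop; lia.
case E : (drop _ _) => [|y s2] /= s2c.
  by move: h2; rewrite -subn_gt0 -size_drop E.
have sE : take (size s)./2 s ++ y :: s2 = s by rewrite -E cat_take_drop.
set s1 := take _ _ in s1c sE *.
move: s1 s1c sE => s1 s1c sE; move: ss {sc s0 h2 E}; rewrite -{}sE {s}.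
rewrite sorted_cat_cons (sorted_pairwise le_trans).
rewrite pairwise_rcons -(sorted_pairwise le_trans) => /andP[/andP[s1y ss1] ys2].
have ss2 : sorted le s2 := path_sorted ys2.
rewrite -/(le x y); have [xy|] := boolP (le x y).
  have [s' [ss' ps'] [-> cs']] := IH s1 (fun s' => K (s' ++ y :: s2)) ss1 s1c.
  exists (s' ++ y :: s2); last by split=> //; rewrite addSn ltnS.
  split; last by rewrite -cat_cons perm_cat2r.
  rewrite sorted_cat_cons ys2 andbT (sorted_pairwise le_trans) pairwise_rcons.
  by rewrite -(sorted_pairwise le_trans) ss' (perm_all _ ps') /= s1y xy.
move=> xy; have yx : le y x by have := le_total x y; rewrite (negbTE xy).
have [s' [ss' ps'] [-> cs']] := IH s2 (fun s' => K (s1 ++ y :: s')) ss2 s2c.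
exists (s1 ++ y :: s'); last by split=> //; rewrite addSn ltnS.
split; last first.
  apply/permP => a; move/permP/(_ a): ps'; rewrite /= !count_cat /=; lia.
rewrite sorted_cat_cons (sorted_pairwise le_trans) pairwise_rcons.
rewrite -(sorted_pairwise le_trans) ss1 s1y (path_sortedE le_trans) ss' andbT.
by rewrite (perm_all _ ps') /= yx (order_path_min le_trans ys2).
Qed.

Lemma sort_treeP c s K : size s <= 2 ^ c ->
  exists2 s', sorted le s' /\ perm_eq s' s
    & output o (sort_tree c s [::] K) = output o (K s') /\
      nqueries o (sort_tree c s [::] K) <= size s * c + nqueries o (K s').
Proof.
suff h s' : sorted le s' -> size s' + size s <= 2 ^ c ->
  exists2 s'', sorted le s'' /\ perm_eq s'' (s' ++ s)
    & output o (sort_tree c s s' K) = output o (K s'') /\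
      nqueries o (sort_tree c s s' K) <= size s * c + nqueries o (K s'').
  exact: (h [::] isT).
elim: s s' => [|x s IH] s' ss' sc /=; first by exists s'; rewrite ?cats0.
have [|t [st pt] [-> ct]] :=
  @insert_treeP c x s' (fun t => sort_tree c s t K) ss'.
  by apply: leq_trans sc; rewrite /= addnS ltnS leq_addr.
have [|t' [st' pt'] [-> ct']] := IH t st.
  by rewrite (perm_size pt) /= addSnnS.
exists t'; last first.
  by split=> //; rewrite mulSn -addnA; apply: leq_trans ct _; rewrite leq_add2l.
split=> //; apply/permP => a; move/permP/(_ a): pt; move/permP/(_ a): pt'.
by rewrite !count_cat /=; lia.
Qed.

End SortingTrees.

(** * Total orders induced by value functions *)

Section ValueOrder.
Variables (T : finType) (D : realDomainType).
Implicit Types u : T -> D.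

Definition value_oracle u (x y : T) : comparison :=
  if (u x < u y)%R then Lt else if u x == u y then Eq else Gt.

Definition value_le u := oracle_le (value_oracle u).

Lemma value_leE u x y : value_le u x y =
  (u x < u y)%R || (u x == u y) && (enum_rank x <= enum_rank y).
Proof. by rewrite /value_le /oracle_le /value_oracle; case: ltgtP. Qed.

Lemma value_le_total u : total (value_le u).
Proof. by move=> x y; rewrite !value_leE; case: ltgtP => //= _; apply: leq_total. Qed.

Lemma value_le_trans u : transitive (value_le u).
Proof.
move=> y x z; rewrite !value_leE => /orP[xy|/andP[/eqP -> xy]].
  by case/orP=> [/(lt_trans xy) ->|/andP[/eqP <- _]] //; rewrite xy.
case/orP=> [->//|/andP[/eqP -> yz]].
by rewrite eqxx (leq_trans xy yz) orbT.
Qed.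

Lemma value_le_anti u : antisymmetric (value_le u).
Proof.
move=> x y; rewrite !value_leE; case: ltgtP => //= _ xy.
by apply/enum_rank_inj/ord_inj/anti_leq.
Qed.

Lemma value_leW u x y : value_le u x y -> (u x <= u y)%R.
Proof. by rewrite value_leE => /orP[/ltW|/andP[/eqP -> _]]. Qed.

End ValueOrder.

(** * The search and its invariant *)

Section Search.
Variables (T I : finType) (D : realDomainType) (v : I -> T -> D).
Variables (infer : seq T -> T -> bool) (k c : nat).
Hypothesis infer_nil : forall x, ~~ infer [::] x.
Hypothesis infer_last : forall g x, infer (rcons g x) x.
Hypothesis infer_rcons : forall g x y, infer g x -> infer (rcons g y) x.
Hypothesis infer_sound : forall i x s y,
  sorted (fun a b => v i a <= v i b)%R (x :: s) -> infer (x :: s) y ->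
  (v i x <= v i y)%R.
Hypothesis independent_leq : forall s, independent infer s -> size s <= k.
Hypothesis k_log : 2 * k <= 2 ^ c.
Implicit Types (Q : {set T}) (H : {set I}) (b : T).

Definition good_sample Q H (S : {ffun 'I_(2 * k) -> T}) :=
  [forall j, S j \in Q] &&
  (2 ^ k * #|[set i in H | bad_sample infer (value_le (v i)) Q S]| <= #|H|).

(** The constant sample is only a default: a good sample exists whenever Q is nonempty. *)
Definition pick_sample Q H b :=
  odflt [ffun=> b] [pick S | good_sample Q H S].

(* Q is the set of points not yet known to be no better than the incumbent b,
   and H the set of value functions compatible with the answers so far. *)
Fixpoint search n Q H b : comparison_alg T :=
  if n is n'.+1 then
    if Q == set0 then Return b else
    let S := pick_sample Q H b in
    sort_tree c (codom S) [::] (fun s =>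
      let g := greedy infer s in
      branch b (head b g) (fun t =>
        search n' (Q :\: [set x | infer g x])
          [set i in H | sort (value_le (v i)) (codom S) == s]
          (if t then b else head b g)))
  else Return b.

Lemma pick_sampleP Q H b : Q != set0 -> good_sample Q H (pick_sample Q H b).
Proof.
move=> Q0; rewrite /pick_sample; case: pickP => [//|none].
have [i|S /forallP SQ SH] := exists_good_sample infer_last infer_rcons
    independent_leq H (le := fun i => value_le (v i)) _ Q0.
  by split; [apply: value_le_total|apply: value_le_trans|apply: value_le_anti].
by have := none S; rewrite /good_sample SQ SH.
Qed.

(** The budgets p and q bound the rounds that shrink Q by the factor 7/8 and those that divide
    [#|H|] by [2 ^ k]. Every round spends one unit of p or q and at most [2 * k * c] queries on
    sorting, plus one to update the incumbent. *)
Lemma searchP p q n Q H b i :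
  i \in H -> 7 ^ p * #|Q| < 8 ^ p -> #|H| < 2 ^ (k * q) -> p + q <= n ->
  (forall x, x \notin Q -> v i b <= v i x)%R ->
  let o := value_oracle (v i) in
  (forall x, v i (output o (search n Q H b)) <= v i x)%R /\
  nqueries o (search n Q H b) <= (p + q) * (2 * k * c).+1.
Proof.
move=> iH; elim: n => [|n IH] in p q Q H b iH *.
  (* Without fuel both budgets are zero, and q = 0 would make H empty although it contains i. *)
  case: p q => [[]|] //= _; rewrite muln0 expn0 ltnS leqn0 => /eqP/cards0_eq H0.
  by move: iH; rewrite H0 inE.
move=> Qp Hq pqn bQ o /=; case: eqVneq => [Q0|Q0] /=.
  by split=> // x; apply: bQ; rewrite Q0 inE.
have /andP[/forallP SQ SH] := pick_sampleP H b Q0.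
set S := pick_sample Q H b in SQ SH *.
set K := (X in sort_tree _ _ _ X).
have [|s [ss sS] [-> cs]] := sort_treeP (@value_le_total _ _ (v i))
    (@value_le_trans _ _ (v i)) (c := c) (s := codom S) K.
  by rewrite size_codom card_ord.
have {sS} sE : s = sort (value_le (v i)) (codom S).
  apply: (sorted_eq (@value_le_trans _ _ _) (@value_le_anti _ _ _)) ss _ _.
    by apply: sort_sorted; apply: value_le_total.
  by rewrite perm_sym perm_sort perm_sym.
set g := greedy infer s; have gE : g = probe infer (value_le (v i)) S by rewrite /g sE.
have gs : sorted (fun a b => v i a <= v i b)%R g.
  apply: (@sub_sorted _ (value_le (v i))) => [x y|]; first exact: value_leW.
  exact: (subseq_sorted (@value_le_trans _ _ _) (greedy_subseq _ _) ss).
set t := tiebreak b (head b g) (o b (head b g)).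
pose b' := if t then b else head b g.
set Q' := Q :\: [set x | infer g x].
pose H' := [set i in H | sort (value_le (v i)) (codom S) == s].
have KE : K s = branch b (head b g)
    (fun t => search n Q' H' (if t then b else head b g)).
  by [].
have b'b : (v i b' <= v i b)%R /\ (v i b' <= v i (head b g))%R.
  rewrite /b' (_ : t = value_le (v i) b (head b g)) //.
  case: ifP => [/value_leW//|nb]; split=> //.
  by have := value_le_total (v i) b (head b g); rewrite nb => /value_leW.
have iH' : i \in H' by rewrite inE iH sE /=.
have b'Q x : x \notin Q' -> (v i b' <= v i x)%R.
  rewrite !inE negb_and negbK => /orP[gx|/bQ]; last exact: le_trans b'b.1.
  apply: le_trans b'b.2 _; move: gx gs; case: (g) => [|y g'] gx gs /=.
    by have := infer_nil x; rewrite gx.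
  exact: infer_sound gs gx.
(* It remains to exhibit smaller budgets that are valid for [Q'] and [H']. *)
have step p' q' : p' + q' < p + q -> 7 ^ p' * #|Q'| < 8 ^ p' ->
    #|H'| < 2 ^ (k * q') ->
  (forall x, v i (output o (K s)) <= v i x)%R /\
  nqueries o (sort_tree c (codom S) [::] K) <= (p + q) * (2 * k * c).+1.
  move=> pq Qp' Hq'.
  have [|h1 h2] := IH p' q' Q' H' b' iH' Qp' Hq' _ b'Q.
    by rewrite -ltnS (leq_trans pq).
  split=> [x|]; first by rewrite KE; apply: h1.
  apply: leq_trans cs _; rewrite size_codom card_ord KE /= -/t -/b'.
  apply: leq_trans (leq_mul pq (leqnn _)).
  by rewrite [leqRHS]mulSn addSn addnS ltnS leq_add2l.
(* Every order left in [H'] sorts the sample as i does and has the same probe. If the sample is bad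
   for i, it is bad for all of [H'], so the choice of the sample bounds [#|H'|]. *)
have [bad|] := boolP (bad_sample infer (value_le (v i)) Q S).
  case: q Hq pqn step => [|q] Hq pqn step.
    move: Hq; rewrite muln0 expn0 ltnS leqn0 cards_eq0 => /eqP H0.
    by rewrite H0 inE in iH.
  apply: (step p q); first by rewrite addnS.
    apply: leq_ltn_trans Qp; rewrite leq_mul2l subset_leq_card ?orbT //.
    exact: subsetDl.
  rewrite -(ltn_pmul2l (expn_gt0 2 k)) -expnD -mulnS; apply: leq_ltn_trans Hq.
  apply: leq_trans SH; rewrite leq_mul2l; apply/orP; right.
  apply/subset_leq_card/subsetP => j; rewrite !inE => /andP[-> /eqP js] /=.
  by move: bad; rewrite /bad_sample /probe js -sE.
rewrite /bad_sample -leqNgt -gE => good.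
(* A sample that is not bad infers at least 1/8 of Q, and these points are discarded. *)
have Q'c : 8 * #|Q'| <= 7 * #|Q|.
  have := cardsID [set x | infer g x] Q.
  rewrite -(_ : [set x in Q | infer g x] = Q :&: [set x | infer g x]).
    by rewrite -/Q'; lia.
  by apply/setP => x; rewrite !inE.
case: p Qp pqn step => [|p] Qp pqn step.
  by move: Qp; rewrite mul1n ltnS leqn0 cards_eq0 (negbTE Q0).
apply: (step p q) => //.
  rewrite -(ltn_pmul2l (_ : 0 < 8)) // -expnS mulnCA; apply: leq_ltn_trans Qp.
  by rewrite expnSr -mulnA leq_mul2l Q'c orbT.
apply: leq_ltn_trans Hq; apply/subset_leq_card/subsetP => j.
by rewrite inE => /andP[].
Qed.

End Search.

(** * Counting traces of homogeneous halfspaces *)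

Section HalfspaceTraces.
Local Open Scope ring_scope.
Variables (X : finType) (K : realFieldType) (d : nat) (u : X -> 'rV[K]_d).
Variable F : {set {set X}}.
Hypothesis halfspaceF : forall A, A \in F ->
  exists w : 'cV_d, forall p, (p \in A) = (0 < (u p *m w) 0 0).

(** Neither a linear dependence of the vectors nor its opposite can have a positive coefficient, so
    every dependence is zero. *)
Lemma shattered_row_free (S : {set X}) :
  shatters F S -> row_free (\matrix_(i < #|S|) u (enum_val i)).
Proof.
move=> /shattersP Ssh; set N := \matrix_i _.
rewrite -kermx_eq0; apply/rowV0P => c /sub_kermxP cN.
(* If e has a positive entry, a halfspace meeting S exactly where e is positive
   pairs positively with e *m N. *)
have e_le0 (e : 'rV_#|S|) : e *m N = 0 -> forall i, e 0 i <= 0.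
  move=> eN i; rewrite leNgt; apply/negP => ei.
  have [|A /halfspaceF[w wA] AS] := Ssh [set enum_val i | i : 'I_#|S| & 0 < e 0 i].
    by apply/subsetP => _ /imsetP[j _ ->]; apply: enum_valP.
  have pE (j : 'I_#|S|) : (0 < (u (enum_val j) *m w) 0 0) = (0 < e 0 j).
    rewrite -wA; transitivity (enum_val j \in A :&: S).
      by rewrite inE enum_valP andbT.
    rewrite AS; apply/imsetP/idP => [[l el /enum_val_inj ->]|ej].
      by rewrite inE in el.
    by exists j; rewrite ?inE.
  have : (e *m N *m w) 0 0 = 0 by rewrite eN mul0mx mxE.
  rewrite -mulmxA mxE; apply/eqP/lt0r_neq0.
  have NE j : (N *m w) j 0 = (u (enum_val j) *m w) 0 0.
    by rewrite !mxE; apply: eq_bigr => l _; rewrite !mxE.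
  rewrite (bigD1 i) //= ltr_pwDl //; first by rewrite NE mulr_gt0 // pE.
  apply: sumr_ge0 => j _; rewrite NE.
  have [ej|ej] := ltP 0 (e 0 j); first by rewrite mulr_ge0 // ltW // pE.
  by rewrite mulr_le0 // leNgt pE -leNgt.
apply/rowP => i; rewrite mxE; apply/eqP; rewrite eq_le e_le0 //=.
have := e_le0 (- c); rewrite mulNmx cN oppr0 => /(_ erefl i).
by rewrite mxE oppr_le0.
Qed.

(** Shattered sets index independent vectors in the row space of M, so they have at most [\rank M]
    elements, and counting shattered sets bounds F. *)
Lemma card_halfspace_traces m (M : 'M[K]_(m, d)) :
  (forall p, u p <= M)%MS -> (#|F| <= #|X|.+1 ^ \rank M)%N.
Proof.
move=> uM; apply: leq_trans (card_shatters F) _.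
apply: leq_trans (card_small_sets X (\rank M)); apply: subset_leq_card.
apply/subsetP => S; rewrite !inE => /shattered_row_free/eqP <-.
by apply/mxrankS/row_subP => i; rewrite rowK.
Qed.

End HalfspaceTraces.

From mathcomp Require Import finmap.
From mathcomp Require Import boolp classical_sets reals exp.

Local Open Scope classical_set_scope.
Local Open Scope fset_scope.
Local Open Scope ring_scope.

(** * Cones, envelopes and linear functionals *)

Section Envelope.
Variables (R : realType) (d : nat).
Implicit Types (V : {fset 'rV[R]_d}) (s : seq 'rV[R]_d) (w x u : 'rV[R]_d).

Lemma innerE w x : inner w x = (x *m w^T) 0 0.
Proof. by rewrite /inner mxE; apply: eq_bigr => i _; rewrite !mxE mulrC. Qed.

Lemma innerB w x u : inner w (x - u) = inner w x - inner w u.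
Proof. by rewrite !innerE mulmxBl !mxE. Qed.

Lemma inner_sum w (I : Type) (r : seq I) (a : I -> R) (F : I -> 'rV[R]_d) :
  inner w (\sum_(i <- r) a i *: F i) = \sum_(i <- r) a i * inner w (F i).
Proof.
rewrite innerE mulmx_suml summxE; apply: eq_bigr => i _.
by rewrite -scalemxAl mxE innerE.
Qed.

Lemma cone_fsubset V W u : V `<=` W -> cone V u -> cone W u.
Proof.
move=> VW [a a0 ->].
exists (fun v => if v \in V then a v else 0) => [v _|].
  by case: ifP => // /a0.
rewrite -(big_fset_incl _ VW) => [|v _ /negbTE ->]; last by rewrite scale0r.
by rewrite !big_seq; apply: eq_bigr => v ->.
Qed.

Lemma cone_mem V v : v \in V -> cone V v.
Proof.
move=> vV; exists (fun u => (u == v)%:R) => [u _|]; first exact: ler0n.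
rewrite (big_fsetD1 v) //= eqxx scale1r big_seq big1 ?addr0 // => u.
by rewrite !inE => /andP[/negbTE -> _]; rewrite scale0r.
Qed.

Lemma env_inner_ge0 w s u :
  (forall i j, (i <= j < size s)%N -> inner w s`_i <= inner w s`_j) ->
  env s u -> 0 <= inner w u.
Proof.
move=> ws [a a0 ->]; rewrite inner_sum big_seq; apply: sumr_ge0 => v vs.
rewrite mulr_ge0 ?a0 //; case/imfsetP: vs => -[i j] /= ij ->.
by rewrite innerB subr_ge0 ws // ltn_ord andbT.
Qed.

Lemma env_nth s i j : (i <= j < size s)%N -> env s (s`_j - s`_i).
Proof.
case/andP=> ij js; apply: cone_mem; apply/imfsetP.
by exists (Ordinal (leq_ltn_trans ij js), Ordinal js).
Qed.

Lemma env_rcons s x u : env s u -> env (rcons s x) u.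
Proof.
apply: cone_fsubset; apply/fsubsetP => v /imfsetP[[i j] /= ij ->].
have ri (l : 'I_(size s)) : (l < size (rcons s x))%N.
  by rewrite size_rcons ltnS ltnW.
apply/imfsetP; exists (Ordinal (ri i), Ordinal (ri j)) => //=.
by rewrite !nth_rcons !ltn_ord.
Qed.

(** A separation certificate: w is constant on the prefix, hence nonnegative on its envelope, but
    negative on the new difference. *)
Lemma env_prefix_separated w s t : (2 <= t <= size s)%N ->
  (forall i, (i < t.-1)%N -> inner w s`_i = inner w s`_0) ->
  inner w s`_t.-1 < inner w s`_0 -> ~ env (take t.-1 s) (s`_t.-1 - s`_0).
Proof.
case: t => [//|t] /= /andP[t0 ts] wi wt envt.
suff : 0 <= inner w (s`_t - s`_0) by rewrite innerB subr_ge0 leNgt wt.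
apply: env_inner_ge0 envt => i j; rewrite size_takel ?(ltnW ts) // => /andP[ij jt].
by rewrite !nth_take ?(leq_ltn_trans ij) // !wi // (leq_ltn_trans ij).
Qed.

End Envelope.

(** * Inference, rank and comparison patterns of a point set *)

Section ConicDimension.
Variables (R : realType) (d : nat) (P : {fset 'rV[R]_d}).
Implicit Types (s : seq P) (x : P) (w : 'rV[R]_d).

Local Notation pt := (@fsval _ P).

(** The guard matters because [nth] defaults to 0: without it the empty sequence would infer the
    zero point. *)
Definition inferred s x : bool :=
  (s != [::]) && `[< env (map pt s) (pt x - (map pt s)`_0) >].

Lemma inferred_last s x : inferred (rcons s x) x.
Proof.
apply/andP; split; first by case: s.
apply/asboolP; rewrite -[in X in X - _](_ : (map pt (rcons s x))`_(size s) = pt x).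
  by apply: env_nth; rewrite size_map size_rcons leqnn.
by rewrite map_rcons nth_rcons size_map ltnn eqxx.
Qed.

Lemma inferred_rcons s x y : inferred s x -> inferred (rcons s y) x.
Proof.
case: s => [//|z s] /andP[_ /asboolP h]; apply/andP; split=> //.
by apply/asboolP; rewrite map_rcons; apply: env_rcons.
Qed.

Lemma inferred_sound w x s y :
  sorted (fun a b => inner w (pt a) <= inner w (pt b)) (x :: s) ->
  inferred (x :: s) y -> inner w (pt x) <= inner w (pt y).
Proof.
move=> xs /andP[_ /asboolP /=]; rewrite -subr_ge0 -innerB.
apply: env_inner_ge0 => i j /andP[ij]; rewrite -map_cons size_map => js.
rewrite !(nth_map x) ?(leq_ltn_trans ij) //.
apply: (sorted_leq_nth _ _ _ xs) => //; rewrite ?inE ?(leq_ltn_trans ij) //.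
by move=> ? ? ?; apply: le_trans.
Qed.

Lemma independent_conic s :
  independent inferred s -> conic_seq [set` P] (map pt s).
Proof.
move=> ind; split=> [y /mapP[x _ ->]|[|[|t]] //]; first exact: fsvalP.
rewrite size_map /= => ts h.
have x0 : P by case: (s) ts.
have := ind (take t.+1 s) (nth x0 s t.+1) (drop t.+2 s).
rewrite -drop_nth // cat_take_drop => /(_ erefl)/negP; apply; apply/andP; split.
  by case: (s) ts.
by apply/asboolP; rewrite map_take nth_take // -(nth_map x0 0 pt).
Qed.

Lemma independent_size k s :
  is_conic_dimension [set` P] k -> independent inferred s -> (size s <= k)%N.
Proof. by move=> [_ dimP] /independent_conic/dimP; rewrite size_map. Qed.

Definition translates x0 : 'M[R]_(#|{: P}|, d) :=
  \matrix_i (pt (enum_val i : P) - pt x0).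

Lemma translates_sub x0 x y : (pt y - pt x <= translates x0)%MS.
Proof.
have h z : (pt z - pt x0 <= translates x0)%MS.
  have := row_sub (enum_rank z) (translates x0).
  by rewrite rowK enum_rankK.
rewrite (_ : pt y - pt x = (pt y - pt x0) - (pt x - pt x0)).
  by rewrite addmx_sub ?eqmx_opp.
by rewrite opprB addrA subrK.
Qed.

(** The base point followed by points with linearly independent translates is a conic sequence, one
    entry longer than the rank. *)
Lemma mxrank_translates_lt k x0 :
  is_conic_dimension [set` P] k -> (\rank (translates x0) < k)%N.
Proof.
move=> [_ dimP]; set M := translates x0.
pose y (i : 'I_(\rank M)) : P := enum_val (maxrankfun M i).
pose s := pt x0 :: [seq pt (y i) | i <- enum 'I_(\rank M)].
suff /dimP : conic_seq [set` P] s by rewrite /= size_map size_enum_ord.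
split=> [z|t /andP[t2 ts]].
  by rewrite inE => /predU1P[->|/mapP[i _ ->]]; exact: fsvalP.
have /row_freeP[B MB] : row_free (rowsub (maxrankfun M) M).
  exact: maxrowsub_free.
have ts' : (t.-2 < \rank M)%N.
  by move: ts; rewrite /= size_map size_enum_ord; case: t t2 => [|[]].
(* The columns of the right inverse B are dual to the chosen translates: w is -1 on the translate at
   index [t.-2], which is entry [t.-1] of s, and 0 on the others. *)
pose w := - (col (Ordinal ts') B)^T.
have wy (i : 'I_(\rank M)) : inner w (pt (y i)) = inner w (pt x0) - (i == Ordinal ts')%:R.
  move/matrixP/(_ i (Ordinal ts')): MB; rewrite [RHS]mxE => <-.
  apply/eqP; rewrite eq_sym subr_eq addrC -subr_eq -opprB -innerB.
  rewrite innerE linearN /= trmxK mulmxN !mxE opprK; apply/eqP.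
  by apply: eq_bigr => j _; rewrite !mxE.
have sE i (ir : (i < \rank M)%N) : s`_i.+1 = pt (y (Ordinal ir)).
  rewrite /= (nth_map (Ordinal ir)) ?size_enum_ord //.
  by congr (pt (y _)); apply/val_inj; rewrite /= nth_enum_ord.
apply: (env_prefix_separated (w := w)); first by rewrite t2.
  case=> // i it; have ir : (i < \rank M)%N by apply: (leq_trans _ ts'); lia.
  by rewrite sE wy -val_eqE /= (_ : i == t.-2 = false) ?subr0 //; lia.
rewrite (_ : t.-1 = t.-2.+1) ?sE; last by lia.
by rewrite wy eqxx gtrBl ltr01.
Qed.

Lemma conic_dimension_gt1 k :
  is_conic_dimension [set` P] k -> (1 < #|{: P}|)%N -> (1 < k)%N.
Proof.
move=> kP /card_gt1P[x [y [_ _ xy]]].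
apply: leq_trans (mxrank_translates_lt x kP); rewrite ltnS lt0n mxrank_eq0.
apply: contra xy => /eqP M0; have := translates_sub x x y.
by rewrite M0 => /submx0null/eqP; rewrite subr_eq0 => /eqP/val_inj ->.
Qed.

(** The strict comparisons determine all oracle answers, so patterns serve as finite names for the
    orderings given by weight vectors. *)
Definition pattern w : {set P * P} :=
  [set p | inner w (pt p.1) < inner w (pt p.2)].

Definition patterns : {set {set P * P}} :=
  [set A | `[< exists w, pattern w = A >]].

(** A pattern is the trace of a halfspace on the differences indexed by the pairs of points, and
    these span a space of dimension below k. *)
Lemma card_patterns k (x0 : P) : is_conic_dimension [set` P] k ->
  (#|patterns| <= (#|{: P}| ^ 2).+1 ^ k)%N.
Proof.
move=> kP; have := @card_halfspace_traces _ _ _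
  (fun p : P * P => pt p.2 - pt p.1) patterns _ _ (translates x0).
rewrite card_prod mulnn => h; apply: leq_trans (h _ _) _.
- move=> A; rewrite inE => /asboolP[w <-]; exists w^T => p.
  by rewrite inE -innerE innerB subr_gt0.
- by move=> p; apply: translates_sub.
- by rewrite leq_pexp2l // ltnW // mxrank_translates_lt.
Qed.

End ConicDimension.

(** * Transport of algorithms along a map of points *)

Section AlgMap.
Variables (T U : Type) (f : T -> U).

Fixpoint alg_map (a : comparison_alg T) : comparison_alg U :=
  match a with
  | Return x => Return (f x)
  | Compare x y next => Compare (f x) (f y) (fun c => alg_map (next c))
  end.

Lemma queries_in_map (Q : U -> Prop) a :
  (forall x, Q (f x)) -> queries_in Q (alg_map a).
Proof. by move=> Qf; elim: a => //= x y next IH; split. Qed.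

Variable o : U -> U -> comparison.
Let o' := fun x y => o (f x) (f y).

Lemma output_map a : output o (alg_map a) = f (output o' a).
Proof. by elim: a => //= x y next IH; rewrite IH. Qed.

Lemma nqueries_map a : nqueries o (alg_map a) = nqueries o' a.
Proof. by elim: a => //= x y next IH; rewrite IH. Qed.

End AlgMap.

Lemma trunc_log_ln (R : realType) n : (0 < n)%N ->
  (trunc_log 2 n)%:R * ln 2 <= ln n%:R :> R.
Proof.
move=> n0; rewrite mulr_natl -lnXn ?ltr0n // -natrX ler_ln ?posrE ?ltr0n ?expn_gt0 //.
by rewrite ler_nat trunc_logP.
Qed.

(** * The search applied to a point set *)

Section Minimization.
Variables (R : realType) (d : nat) (P : {fset 'rV[R]_d}) (k : nat).
Hypothesis kP : is_conic_dimension [set` P] k.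
Local Notation pt := (@fsval _ P).
Local Notation n := #|{: P}|.

(** A chosen weight vector realizing A, with default 0 if there is none. It may differ from the
    unknown vector but answers every query alike. *)
Definition pattern_weight (A : {set P * P}) : 'rV[R]_d :=
  xget 0 [set w | pattern P w = A].

Definition pattern_value (A : {set P * P}) (x : P) : R :=
  inner (pattern_weight A) (pt x).

Lemma pattern_weightK w : pattern P (pattern_weight (pattern P w)) = pattern P w.
Proof. by apply: (@xgetPex _ 0 [set u | pattern P u = pattern P w]); exists w. Qed.

Lemma pattern_valueE w (x y : P) :
  (pattern_value (pattern P w) x < pattern_value (pattern P w) y)
  = (inner w (pt x) < inner w (pt y)).
Proof.
by have /setP/(_ (x, y)) := pattern_weightK w; rewrite !inE.
Qed.

Lemma pattern_oracle w :
  value_oracle (pattern_value (pattern P w))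
  = (fun x y => weight_oracle w (pt x) (pt y)).
Proof.
apply/funext => x; apply/funext => y; rewrite /value_oracle /weight_oracle.
rewrite pattern_valueE; case: ifP => // xy.
by rewrite !eq_le !(leNgt _ (pattern_value _ _)) !(leNgt _ (inner _ _)) !pattern_valueE.
Qed.

Lemma exists_minimizing_tree : (1 < n)%N ->
  exists a : comparison_alg P, forall w,
    let o x y := weight_oracle w (pt x) (pt y) in
    (forall y, inner w (pt (output o a)) <= inner w (pt y)) /\
    (nqueries o a <= 162 * k * trunc_log 2 k * trunc_log 2 n)%N.
Proof.
move=> n1; have k1 := conic_dimension_gt1 kP n1.
have [x0 _] : exists x0 : P, x0 \in {: P} by apply/card_gt0P/ltnW.
set tk := trunc_log 2 k; set tn := trunc_log 2 n.
have tk1 : (0 < tk)%N by rewrite trunc_log_gt0.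
have tn1 : (0 < tn)%N by rewrite trunc_log_gt0.
have nL : (n < 2 ^ tn.+1)%N by apply: trunc_log_ltn.
have kc : (2 * k <= 2 ^ tk.+2)%N.
  by rewrite [leqRHS]expnS leq_mul2l ltnW ?orbT // trunc_log_ltn.
pose L := tn.+1.
(* With [L = tn.+1], the fuel [9 * L] splits into [6 * L] for the points, since
   [2 * 7 ^ 6 <= 8 ^ 6], and [3 * L] for the patterns, since [n ^ 2 + 1 < 2 ^ (3 * L)]. *)
exists (search pattern_value (@inferred R d P) k tk.+2 (9 * L)
  (~: [set x0]) (patterns P) x0) => w o.
have wP : pattern P w \in patterns P by rewrite inE; apply/asboolP; exists w.
have Q2 : (#|~: [set x0]| < 2 ^ L)%N := leq_ltn_trans (max_card _) nL.
have [||||h1 h2] := @searchP _ _ _ pattern_value (@inferred R d P) k tk.+2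
  (fun _ => erefl) (@inferred_last _ _ _) (@inferred_rcons _ _ _)
  (fun i => @inferred_sound _ _ _ (pattern_weight i))
  (fun s => independent_size kP) kc (6 * L) (3 * L) (9 * L) (~: [set x0])
  (patterns P) x0 (pattern P w) wP.
- apply: (@leq_trans (7 ^ (6 * L) * 2 ^ L)); first by rewrite ltn_pmul2l ?expn_gt0.
  by rewrite !expnM -expnMn leq_exp2r.
- apply: leq_ltn_trans (card_patterns x0 kP) _.
  rewrite mulnC expnM ltn_exp2r ?(ltnW k1) // mulnC expnM.
  set z := (2 ^ L)%N in nL *; rewrite -mulnn; nia.
- by rewrite -mulnDl.
- by move=> x; rewrite !inE negbK => /eqP ->.
move: h1 h2; rewrite pattern_oracle -/o => h1 h2; split=> [y|].
  rewrite leNgt -pattern_valueE -leNgt; exact: h1.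
apply: leq_trans h2 _.
(* Since [tk] and [tn] are positive, [tn.+1 <= 2 * tn] and [2 * k * tk.+2 + 1 <= 9 * k * tk], and
   [9 * 2 * 9 = 162]. *)
rewrite /L; nia.
Qed.

End Minimization.

(** * The algorithm on the ambient space, with real logarithms *)

Lemma exists_minimizing_alg (R : realType) (d : nat) (P : {fset 'rV[R]_d}) :
  exists a : comparison_alg 'rV[R]_d, forall k : nat,
    P != fset0 -> is_conic_dimension [set` P] k ->
    queries_in (fun x => x \in P) a /\
    forall w : 'rV[R]_d,
      is_minimizer P w (output (weight_oracle w) a) /\
      (nqueries (weight_oracle w) a)%:R
        <= (162 / ln 2 ^+ 2 : R) * (k%:R * ln k%:R * ln #|` P|%:R).
Proof.
have [[k kP]|none] := pselect (exists k, is_conic_dimension [set` P] k); last first.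
  by exists (Return 0) => k _ kP; case: none; exists k.
(* The algorithm is chosen before k is quantified; uniqueness of the dimension makes the choice
   harmless. *)
have kU k' : is_conic_dimension [set` P] k' -> k' = k.
  move=> [[s sP <-] k'max]; case: kP => [[t tP <-] kmax].
  by apply/eqP; rewrite eqn_leq kmax ?k'max.
have [P0|/fset0Pn[x xP]] := eqVneq P fset0.
  by exists (Return 0) => k'.
have ln2 : 0 < ln 2 :> R by rewrite ln_gt0 // ltr1n.
(* A single point needs no query, and the bound is 0 because [ln 1 = 0]. *)
have [n1|n1] := leqP #|{: P}| 1.
  exists (Return x) => k' _ /kU ->; split=> // w; split.
    split=> // y yP; have /fintype_le1P := n1.
    move=> /(_ [` xP] [` yP])/(congr1 (@fsval _ P)) /= ->; exact: lexx.
  rewrite (_ : #|` P| = 1%N) ?ln1 ?mulr0 //.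
  apply/eqP; rewrite eqn_leq cardfs_gt0 cardfE n1 /=.
  by apply/fset0Pn; exists x.
have [a aP] := exists_minimizing_tree kP n1.
exists (alg_map (@fsval _ P) a) => k' _ /kU ->; split.
  by apply: queries_in_map => y; exact: fsvalP.
move=> w; have [a1 a2] := aP w; rewrite output_map nqueries_map; split.
  by split=> [|y yP]; [exact: fsvalP|exact: (a1 [` yP])].
have k1 := conic_dimension_gt1 kP n1.
apply: (@le_trans _ _ (162 * k%:R * (trunc_log 2 k)%:R * (trunc_log 2 #|{: P}|)%:R)).
  by rewrite -!natrM ler_nat.
(* Passing from the two binary logarithms to natural ones gives the factor [ln 2 ^+ 2] in the
   constant. *)
have tk := trunc_log_ln R (ltnW k1); have tn := trunc_log_ln R (ltnW n1).
have ge0 m : 0 <= m%:R * ln 2 :> R by rewrite mulr_ge0 // ltW.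
have tkn := ler_pM (ge0 _) (ge0 _) tk tn.
rewrite cardfE [leRHS]mulrAC ler_pdivlMr ?exprn_gt0 //.
rewrite [leLHS](_ : _ = 162 * k%:R * ((trunc_log 2 k)%:R * ln 2 *
  ((trunc_log 2 #|{: P}|)%:R * ln 2))); last by ring.
by rewrite -(mulrA k%:R) [leRHS]mulrA ler_wpM2l // mulr_ge0.
Qed.

Theorem mainTheorem2 (R : realType) :
  exists (A : forall d : nat, {fset 'rV[R]_d} -> comparison_alg 'rV[R]_d)
         (C : R),
    forall (d : nat) (P : {fset 'rV[R]_d}) (k : nat),
      P != fset0 ->
      is_conic_dimension [set` P] k ->
      queries_in (fun x => x \in P) (A d P) /\
      forall w : 'rV[R]_d,
        is_minimizer P w (output (weight_oracle w) (A d P)) /\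
        (nqueries (weight_oracle w) (A d P))%:R
          <= C * (k%:R * ln k%:R * ln #|` P|%:R).
Proof.
exists (fun d P => projT1 (cid (@exists_minimizing_alg R d P))), (162 / ln 2 ^+ 2).
by move=> d P; case: cid.
Qed.
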